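(* Let $T=(V,E)$ be a tree and let $S\subseteq V$ be a stable set of $T$ with $|S|\geq |V|/2$. Then $S\cap pend(T)\neq\varnothing$. Moreover, if $S-pend(T)\neq\varnothing$, then there exist $v\in S\cap pend(T)$ and $w\in S$ such that the distance between $v$ and $w$ in $T$ equals $2$.
   Context: All graphs are finite, simple and undirected. A tree is a connected acyclic graph of order (number of vertices) greater than one. A set of vertices is stable if no two of its vertices are adjacent. A vertex $v$ of a graph $G$ is pendant if it has exactly one neighbor in $G$, and $pend(G)$ denotes the set of all pendant vertices of $G$. *)

(* Defs.v *)
From HB Require Import structures.
From mathcomp Require Import all_boot.

Set Implicit Arguments.
Unset Strict Implicit.
Unset Printing Implicit Defensive.

(* Graphs are given by their adjacency relation on a finite vertex type.      *)
Section Graphs.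

Variables (V : finType) (e : rel V).

Definition simple_graph : Prop := symmetric e /\ irreflexive e.

Definition connected_graph : Prop := forall x y : V, connect e x y.

(* The size bound is needed because an edge x - y makes [:: x; y] a ucycle.   *)
Definition acyclic : Prop := forall c : seq V, 2 < size c -> ~ ucycle e c.

Definition tree : Prop :=
  [/\ simple_graph, connected_graph, acyclic & 1 < #|V|].

Definition stable (S : {set V}) : Prop := {in S &, forall x y, ~~ e x y}.

Definition neighbors (x : V) : {set V} := [set y | e x y].

Definition pend : {set V} := [set x | #|neighbors x| == 1].

Definition walk_of_length (n : nat) (x y : V) : bool :=
  [exists p : n.-tuple V, path e x p && (last x p == y)].

(* A shortest walk between connected vertices has length less than #|V|, so   *)
(* the bounded search finds it; the value is #|V| when there is no walk.      *)
Definition dist (x y : V) : nat :=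
  find (fun n => walk_of_length n x y) (iota 0 #|V|).

End Graphs.

(* Main.v *)
Require Import Defs.
From mathcomp Require Import all_boot.

(** Root the tree at a vertex [r].  Among the neighbors of a vertex [x <> r]
    at most one is not a child of [x].  Hence, if every vertex of a nonempty
    set [B] has two neighbors in a disjoint set [C], and [r] is taken in [C],
    then every vertex of [B] has a child in [C :\ r].  A vertex has a single
    parent, so [#|B| <= #|C :\ r| < #|C|] ([card_lt_two_neighbors]).

    Let [A := S :&: pend e] and [B := S :\: pend e], and suppose that no vertex
    of [A] has a common neighbor with another vertex of [S].  Then the vertices
    of [A] have distinct neighbors; let [N] be the set of these, so that
    [#|N| = #|A|] and [N] is disjoint from [S].  No vertex of [B] is adjacent to
    [N], nor to [S] by stability, so its neighbors, of which there are at least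
    two, all lie in [C := ~: (S :|: N)].  If [B] is nonempty, this gives
    [#|B| < #|C| = #|V| - #|S| - #|A| <= #|S| - #|A| = #|B|], which is absurd.
    So a nonempty [B] forces a vertex of [A] and another vertex of [S] to have a
    common neighbor, and these two are at distance 2.  In particular [A] is
    nonempty when [B] is; and when [B] is empty, [A] is the set [S], which is
    nonempty by its cardinality. *)

Section Trees.

Set Implicit Arguments.
Unset Strict Implicit.

Variables (V : finType) (e : rel V).

(** A detour around [x] from one neighbor of [x] to another closes up into a
    cycle through [x] once its loops are removed. *)
Lemma acyclic_no_detour (x y z : V) (p : seq V) :
    symmetric e -> acyclic e -> e x y -> e x z -> y != z ->
  path e y p -> last y p = z -> x \notin y :: p -> False.
Proof.
move=> sym_e acy exy exz yz ep lp xp.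
move: lp; case/shortenP: ep => q eq uq sub lq.
case: q => [|w q] in eq uq sub lq; first by rewrite -lq eqxx in yz.
apply: (acy [:: x, y, w & q]) => //; apply/andP; split.
  by move: eq lq; rewrite (cycle_path x) /= => -> ->; rewrite sym_e exz exy.
rewrite cons_uniq uq andbT; apply: contra xp.
by rewrite !(in_cons y) => /orP[->//|/sub ->]; rewrite orbT.
Qed.

(** The vertex [f c] is the parent of [c] in the tree rooted at [r], the first
    step of a simple path from [c] to [r].  Two neighbors [y] and [z] of [x]
    cannot both fail to be children of [x]: both could then reach [r] without
    meeting [x], which gives a detour from [y] to [z] around [x]. *)
Lemma tree_parent (r : V) : tree e ->
  exists2 f : V -> V, f r = r &
    forall x y z, x != r -> e x y -> e x z -> y != z -> f y = x \/ f z = x.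
Proof.
case=> -[sym_e irr_e] conn acy _.
(* The default value of head makes the root its own parent. *)
have /fin_all_exists[f fP] (c : V) : exists h, exists p,
    [/\ path e c p, last c p = r, uniq (c :: p) & h = head r p].
  have /connectP[p ep ->] := conn c r.
  by case/shortenP: ep => q eq uq _; exists (head (last c q) q), q.
exists f.
  have [[|a p] [_ /= lp up ->]] := fP r => //.
  by move: up; rewrite -{1}lp mem_last.
move=> x y z xr exy exz yz.
(* If the path from c to r met its neighbor x after the first step, a piece
   of it and the edge between c and x would form a cycle. *)
have avoid c : e x c -> f c != x ->
    exists p, [/\ path e c p, last c p = r & x \notin c :: p].
  move=> exc; have [p [ep lp up ->]] := fP c => hx.
  exists p; split => //.
  rewrite in_cons negb_or; apply/andP; split.
    by apply: contraTneq exc => ->; rewrite irr_e.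
  case: p ep lp up hx => [|h p] //= /andP[ech ep] lp /andP[cp _] hx.
  rewrite in_cons eq_sym negb_or hx; apply/negP => xp.
  case/splitPr: xp ep cp {lp} => p1 p2.
  rewrite -cat_rcons cat_path => /andP[ep1 _] cp.
  have ecx : e c x by rewrite sym_e.
  apply: (acyclic_no_detour sym_e acy ech ecx hx ep1); first exact: last_rcons.
  by apply: contra cp; rewrite !(in_cons h) mem_cat; case: (c == h) => //= ->.
have [|fyx] := eqVneq (f y) x; first by left.
have [|fzx] := eqVneq (f z) x; first by right.
have [p [ep lp xp]] := avoid y exy fyx.
have [q [eq lq xq]] := avoid z exz fzx.
have eq' : path e r (rev (belast z q)).
  by rewrite -lq rev_path; under eq_path do rewrite sym_e.
case: (@acyclic_no_detour x y z (p ++ rev (belast z q))) => //.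
- by rewrite cat_path ep lp.
- rewrite last_cat lp; case: q lq {eq xq eq'} => [|a q] /=; first by move=> ->.
  by rewrite rev_cons last_rcons.
- rewrite -cat_cons mem_cat negb_or xp mem_rev.
  by apply: contra xq; apply: mem_belast.
Qed.

(** The children in [C] show that [B] lies in the image of [C :\ r] under the
    parent function; taking the root in [C] makes the inequality strict. *)
Lemma card_lt_two_neighbors (B C : {set V}) :
    tree e -> [disjoint B & C] -> B != set0 ->
  {in B, forall b, 1 < #|neighbors e b :&: C|} -> #|B| < #|C|.
Proof.
move=> tree_e dBC /set0Pn[b0 Bb0] deg.
have /card_gt1P[r [_ [/setIP[_ Cr] _ _]]] := deg _ Bb0.
have [f fr fP] := tree_parent r tree_e.
suff subB : B \subset f @: (C :\ r).
  rewrite (cardsD1 r C) Cr ltnS.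
  exact: leq_trans (subset_leq_card subB) (leq_imset_card _ _).
apply/subsetP => b Bb.
have br : b != r by apply: contraTneq Bb => ->; rewrite (disjointFl dBC).
have child c : c \in C -> f c = b -> b \in f @: (C :\ r).
  move=> Cc fc; apply/imsetP; exists c => //; rewrite !inE Cc andbT.
  by apply: contraNneq br => cr; rewrite -fc cr fr.
have /card_gt1P[y [z [/setIP[+ Cy] /setIP[+ Cz] yz]]] := deg _ Bb.
rewrite !inE => eby ebz.
by have [] := fP b y z br eby ebz yz; apply: child.
Qed.

Lemma tree_neighbors_gt0 (x : V) : tree e -> 0 < #|neighbors e x|.
Proof.
case=> _ conn _ /card_gt1P[y [z [_ _ yz]]].
have [t xt] : exists t, x != t.
  by have [xy|] := eqVneq x y; [exists z; rewrite xy | exists y].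
have /connectP[[|u p]] := conn x t; first by move=> _ tx; rewrite tx eqxx in xt.
by move=> /andP[exu _] _; apply/card_gt0P; exists u; rewrite inE.
Qed.

Lemma dist2 (v u w : V) :
  irreflexive e -> e v u -> e u w -> v != w -> ~~ e v w -> dist e v w = 2.
Proof.
move=> irr_e evu euw vw nvw.
have V3 : 2 < #|V|.
  apply/card_gt2P; exists v, u, w; split => //; split=> //.
  - by apply: contraTneq evu => ->; rewrite irr_e.
  - by apply: contraTneq euw => ->; rewrite irr_e.
  - by rewrite eq_sym.
have w0 : walk_of_length e 0 v w = false.
  by apply/existsP => -[p]; rewrite tuple0 /= (negbTE vw).
have w1 : walk_of_length e 1 v w = false.
  apply/existsP => -[[[|a [|b p]] //= _]].
  by rewrite andbT => /andP[eva /eqP aw]; rewrite -aw eva in nvw.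
have w2 : walk_of_length e 2 v w.
  by apply/existsP; exists [tuple u; w]; rewrite /= evu euw eqxx.
by rewrite /dist -(subnKC V3) /= w0 w1 w2.
Qed.

(** The counting argument, with [g v] the only neighbor of [v] when [v] is
    pendant, so that [g @: A] is the set of neighbors of [A]. *)
Lemma pendant_common_neighbor (S : {set V}) :
    tree e -> stable e S -> #|V| <= 2 * #|S| -> S :\: pend e != set0 ->
  exists v u w, [/\ v \in S :&: pend e, w \in S, v != w, e v u & e u w].
Proof.
move=> tree_e stable_S card_S B0; have [[sym_e irr_e] _ _ _] := tree_e.
set A := S :&: pend e; set B := S :\: pend e in B0 *.
have [/existsP[v /existsP[u /existsP[w /and5P[? ? ? ? ?]]]]|nex] := boolP
    [exists v, exists u, exists w, [&& v \in A, w \in S, v != w, e v u & e u w]].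
  by exists v, u, w.
have only_one v u w : v \in A -> w \in S -> e v u -> e w u -> v = w.
  move=> Av Sw evu ewu; apply/eqP; apply: contraNT nex => vw.
  apply/existsP; exists v; apply/existsP; exists u; apply/existsP; exists w.
  by rewrite Av Sw vw evu sym_e ewu.
have /fin_all_exists[g gP] v : exists u, e v u.
  by have /card_gt0P[u] := tree_neighbors_gt0 v tree_e; rewrite inE; exists u.
have AS v : v \in A -> v \in S by case/setIP.
have cardN : #|g @: A| = #|A|.
  apply: card_in_imset => a a' Aa Aa' gaa'.
  by apply: (only_one a (g a)) => //; [apply: AS | rewrite gaa'].
have dSN : [disjoint S & g @: A].
  apply/pred0P => s; apply/negP => /andP[/= Ss /imsetP[a Aa sga]].
  by have /negP[] := stable_S _ _ (AS _ Aa) Ss; rewrite sga.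
have : #|B| < #|~: (S :|: g @: A)|.
  apply: card_lt_two_neighbors => //.
    apply/pred0P => b; apply/negP; rewrite /= !inE.
    by case/andP=> /andP[_ ->].
  move=> b /setDP[Sb]; rewrite inE => deg1.
  suff /setIidPl-> : neighbors e b \subset ~: (S :|: g @: A).
    by rewrite ltn_neqAle eq_sym deg1 tree_neighbors_gt0.
  apply/subsetP => y; rewrite !inE negb_or => eby; apply/andP; split.
    by apply: contraL eby; apply: stable_S.
  apply/imsetP => -[a Aa yga].
  have ab : a = b by apply: (only_one a y) => //; rewrite yga.
  by case/setIP: Aa => _; rewrite ab inE (negbTE deg1).
have cardC := cardsC (S :|: g @: A).
have cardU : #|S :|: g @: A| = #|S| + #|A|.
  by rewrite cardsU -cardN (disjoint_setI0 dSN) cards0 subn0.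
have cardSAB : #|A| + #|B| = #|S| := cardsID (pend e) S.
rewrite ltnNge -(leq_add2l (#|S| + #|A|)) -{1}cardU cardC -addnA cardSAB.
by rewrite addnn -mul2n card_S.
Qed.

End Trees.

Theorem theorem2p2 (V : finType) (e : rel V) (tree_e : tree e)
    (S : {set V}) (stable_S : stable e S) (card_S : #|V| <= 2 * #|S|) :
  S :&: pend e != set0 /\
  (S :\: pend e != set0 ->
   exists v w : V, [/\ v \in S :&: pend e, w \in S & dist e v w = 2]).
Proof.
have [[_ irr_e] _ _ V2] := tree_e.
have common := pendant_common_neighbor tree_e stable_S card_S.
split; last first.
  case/common=> v [u [w [Av Sw vw evu euw]]]; exists v, w; split=> //.
  apply: (dist2 irr_e evu euw vw); apply: stable_S => //.
  by case/setIP: Av.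
have [B0|/common[v [u [w [Av _ _ _ _]]]]] := eqVneq (S :\: pend e) set0; last first.
  by apply/set0Pn; exists v.
rewrite -card_gt0 -(addn0 #|_|) -{2}(cards0 V) -B0 cardsID.
by case: #|S| card_S => // /(leq_trans V2).
Qed.
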